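(* There exist a non-ergodic measure preserving system $(Y,\mathcal{B},\nu,S)$ and a function $f\in L^{\infty}(\nu)\cap\mathcal{K}^{\perp}$ such that for $\nu$-a.e. $y\in Y$ one can find bounded sequences of scalars $(a_n)$ and $(b_n)$ for which the averages $$\frac{1}{N^2}\sum_{n,m=1}^N a_n b_m f(S^{n+m}y)$$ do not converge as $N\to\infty$. In other words, the following assertion, which holds for ergodic systems $(X,\mathcal{B},\mu,T)$, is false if the ergodicity assumption is removed: for every $f\in\mathcal{K}^\perp$, for $\mu$-a.e. $x$, for all bounded sequences $(a_n),(b_n),(c_n)$ of scalars, one has $\lim_N\frac{1}{N^2}\sum_{n,m=0}^{N-1}a_nb_mf(T^{n+m}x)=0$, $\lim_N\frac{1}{N^2}\sum_{n,m=0}^{N-1}f(T^nx)b_mc_{n+m}=0$ and $\lim_N\frac{1}{N^2}\sum_{n,m=0}^{N-1}a_nf(T^mx)c_{n+m}=0$.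
   Context: For a measure preserving transformation (ergodic or not) of a probability space, $\mathcal{K}$ denotes the $\sigma$-algebra generated by the ($L^2$) eigenfunctions of the transformation, and $\mathcal{K}^{\perp}$ denotes the set of $L^2$ functions orthogonal to all $\mathcal{K}$-measurable $L^2$ functions, i.e. those $f$ whose conditional expectation on $\mathcal{K}$ vanishes. The sequences $(a_n),(b_n)$ are allowed to depend on $y$. *)

(* Defs.v *)
From HB Require Import structures.
From mathcomp Require Export all_boot all_order all_algebra complex.
From mathcomp Require Export all_classical all_reals all_analysis.

Set Implicit Arguments.
Unset Strict Implicit.
Unset Printing Implicit Defensive.

Import Order.TTheory GRing.Theory Num.Theory.
Export numFieldNormedType.Exports.

Local Open Scope classical_set_scope.
Local Open Scope ring_scope.

(* The scalars are the complex numbers R[i]; the alias R[i]^o is used where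
   their norm topology is needed. *)

(* Borel measurability of a complex function, through its coordinates. *)
Definition cmeasurable_fun (R : realType) (d : measure_display)
    (T : measurableType d) (f : T -> R[i]) : Prop :=
  measurable_fun [set: T] (fun x => complex.Re (f x)) /\
  measurable_fun [set: T] (fun x => complex.Im (f x)).

Section MeasurableDynamics.
Context (R : realType) (d : measure_display) (T : measurableType d).
Context (mu : probability T R) (S : T -> T).
Implicit Types f g : T -> R[i].

Definition measure_preserving : Prop :=
  measurable_fun [set: T] S /\
  forall A : set T, measurable A -> mu (S @^-1` A) = mu A.

Definition ergodic : Prop :=
  forall A : set T, measurable A -> S @^-1` A = A ->
    mu A = 0%E \/ mu A = 1%E.

Definition in_Lp (p : \bar R) f : Prop :=
  cmeasurable_fun f /\ finite_norm mu p (fun x => complex.Re `|f x|).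

Definition inner f g : R[i] :=
  Complex (\int[mu]_x complex.Re (f x * (g x)^*%C))
          (\int[mu]_x complex.Im (f x * (g x)^*%C)).

Definition eigenfunction g : Prop :=
  [/\ in_Lp 2%:E g,
      ~ {ae mu, forall x, g x = 0} &
      exists lambda : R[i], {ae mu, forall x, g (S x) = lambda * g x}].

(* Eigenfunctions are pointwise representatives of their L^2 classes, and all
   representatives are used, so the generated sigma-algebra contains the
   measurable null sets. *)
Definition eigen_sets : set (set T) :=
  [set A | exists g (B : set R), [/\ eigenfunction g, measurable B &
     A = (fun x => complex.Re (g x)) @^-1` B \/
     A = (fun x => complex.Im (g x)) @^-1` B]].

Definition kronecker_measurable f : Prop :=
  cmeasurable_fun (f : g_sigma_algebraType eigen_sets -> R[i]).

Definition kronecker_perp f : Prop :=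
  in_Lp 2%:E f /\
  forall g, in_Lp 2%:E g -> kronecker_measurable g -> inner f g = 0.

(* The exceptional null set may depend on f but not on the weights. *)
Definition weighted_averages_vanish : Prop :=
  forall f, kronecker_perp f ->
  {ae mu, forall x, forall a b c : nat -> R[i]^o,
    bounded_fun a -> bounded_fun b -> bounded_fun c ->
    [/\ (fun N : nat => (N%:R ^+ 2)^-1 * \sum_(0 <= n < N) \sum_(0 <= m < N)
           a n * b m * f (iter (n + m) S x) : R[i]^o) @ \oo --> (0 : R[i]^o),
        (fun N : nat => (N%:R ^+ 2)^-1 * \sum_(0 <= n < N) \sum_(0 <= m < N)
           f (iter n S x) * b m * c (n + m)%N : R[i]^o) @ \oo --> (0 : R[i]^o) &
        (fun N : nat => (N%:R ^+ 2)^-1 * \sum_(0 <= n < N) \sum_(0 <= m < N)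
           a n * f (iter m S x) * c (n + m)%N : R[i]^o) @ \oo --> (0 : R[i]^o)]}.

End MeasurableDynamics.

(* Main.v *)
(* On the torus with S(alpha, t) = (alpha, t + alpha), the character e(t) is
   orthogonal to every eigenfunction, although e(t) restricted to a single fibre
   is an eigenfunction, of eigenvalue e(alpha).  Choosing b_m = e(- m alpha) and
   a_n = u_n e(- n alpha), the averages become e(t) times the Cesaro means of
   u_n, which diverge when u_n is a sign that is constant on dyadic blocks.

   The orthogonality follows from the invariance of every eigenfunction g under
   the half turn t |-> t + 1/2, which changes the sign of e(t).  Let psi be
   1-periodic with psi(x + 1/2) = - psi(x), and phi a bounded function of alpha.
   The functions F_n = psi(t + n alpha) satisfy F_n o S = F_(n+1), so the
   correlations of phi g with the F_n all have the same modulus; the F_n being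
   pairwise orthogonal and bounded, Bessel's inequality makes them vanish. *)
From HB Require Import structures.
Require Import Defs.
From mathcomp Require Import measurable_realfun ess_sup_inf ring lra.

Set Implicit Arguments.
Unset Strict Implicit.
Unset Printing Implicit Defensive.

Import Order.TTheory GRing.Theory Num.Theory.

Local Open Scope classical_set_scope.
Local Open Scope ring_scope.

(** * Reduction of real numbers modulo 1 *)

Section FractionalPart.
Context (R : realType).
Implicit Types x y : R.

Definition frac x : R := x - (Num.floor x)%:~R.

Lemma frac_itv x : 0 <= frac x < 1.
Proof. by rewrite /frac; have := floor_itv x; rewrite intrD; lra. Qed.

Lemma frac_id x : 0 <= x < 1 -> frac x = x.
Proof. by move=> x01; rewrite /frac (@floor_def _ _ 0) ?subr0. Qed.

Lemma fracDz x (k : int) : frac (x + k%:~R) = frac x.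
Proof.
by rewrite /frac floorDrz ?intr_int// intrKfloor intrD opprD addrACA subrr addr0.
Qed.

Lemma fracDn x (n : nat) : frac (x + n%:R) = frac x.
Proof. exact: (fracDz x n). Qed.

Lemma fracE x : exists k : int, frac x = x + k%:~R.
Proof. by exists (- Num.floor x); rewrite mulrNz. Qed.

Lemma frac_fracD x y : frac (frac x + y) = frac (x + y).
Proof. by have [k ->] := fracE x; rewrite addrAC fracDz. Qed.

Lemma frac_frac x : frac (frac x) = frac x.
Proof. by rewrite frac_id ?frac_itv. Qed.

Lemma measurable_frac : measurable_fun [set: R] frac.
Proof.
apply: measurable_funB => //.
by apply: nondecreasing_measurable => // x y xy;
   rewrite ler_int le_floor.
Qed.

End FractionalPart.

(** * Lebesgue measure on the circle and its rotations *)

Section Circle.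
Context (R : realType).
Local Notation mu := (@lebesgue_measure R).

Lemma measurable_addr (x : R) : measurable_fun [set: R] (fun t => t + x).
Proof. by apply: measurable_funD. Qed.

Lemma lebesgue_measure_translation (x : R) (A : set R) : measurable A ->
  mu ((fun t => t + x) @^-1` A) = mu A.
Proof.
move=> mA; apply/esym; pose f : measurableTypeR R -> measurableTypeR R :=
  fun t => t + x.
have mf : measurable_fun [set: measurableTypeR R] f by exact: measurable_addr.
pose mf_mixin := isMeasurableFun.Build _ _ _ _ _ mf.
pose mf_pack : {mfun _ >-> _} := HB.pack f mf_mixin.
apply: (@lebesgue_measure_unique R (pushforward mu mf_pack)) => // _ [[a b] _ <-].
rewrite /= -[RHS]/(mu (f @^-1` `]a, b]%classic)).
have -> : f @^-1` `]a, b]%classic = `]a - x, b - x]%classic.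
  by apply/seteqP; split => t /=; rewrite !in_itv/= /f ltrBlDr lerBrDr.
rewrite !lebesgue_measure_itv/= !lte_fin ltrD2r.
by case: ifP => // _; rewrite -!EFinB; congr EFin; ring.
Qed.

(** The circle is carried by the whole real line, the complement of [[0, 1[] being a null set.
    Identities that need a representative in [[0, 1[] therefore hold almost everywhere. *)
Definition circle_measure : set (measurableTypeR R) -> \bar R :=
  mrestr mu (measurable_itv `[0 : R, 1[).

HB.instance Definition _ := Measure.on circle_measure.

Lemma circle_setT : circle_measure [set: R] = 1%E.
Proof.
by rewrite /circle_measure /mrestr setTI lebesgue_measure_itv/= lte01 oppr0 adde0.
Qed.

HB.instance Definition _ :=
  Measure_isProbability.Build _ _ R circle_measure circle_setT.

Lemma circle_measureE (A : set R) : circle_measure A = mu (A `&` `[0, 1[).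
Proof. by []. Qed.

Definition rot (x t : R) : R := frac (t + x).

Lemma measurable_rot x : measurable_fun [set: R] (rot x).
Proof. exact: measurableT_comp (@measurable_frac R) (measurable_addr x). Qed.

(** The 1-periodic extension of [A] turns the rotation into a translation. The translated window
    [[r, 1 + r[] is cut at 1, and its end [[1, 1 + r[] is moved back to [[0, r[] by periodicity. *)
Lemma circle_rot (x : R) (A : set R) : measurable A ->
  circle_measure (rot x @^-1` A) = circle_measure A.
Proof.
move=> mA; pose r := frac x.
have r01 : 0 <= r < 1 := frac_itv x.
have -> : rot x @^-1` A = rot r @^-1` A.
  suff rotr : rot x = rot r by rewrite rotr.
  by apply/funext => t; rewrite /rot /r ![t + _]addrC frac_fracD.
pose E := @frac R @^-1` A.
have mE : measurable E by rewrite -[E]setTI; exact: measurable_frac.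
(* [A] and its periodic extension [E] have the same trace on [[0, 1[]. *)
have -> : circle_measure A = circle_measure E.
  rewrite !circle_measureE; congr (mu _); apply/seteqP.
  by split=> t [] + t01; move: (t01); rewrite /= in_itv/= /E/= => /frac_id ->.
have mI (i : interval R) : measurable (E `&` [set` i]) by exact: measurableI.
have shift (i j : interval R) (c : R) :
    (forall t, (t \in i) = (t + c \in j)) ->
    mu ((fun t => t + c) @^-1` E `&` [set` i]) = mu (E `&` [set` j]).
  move=> ij; rewrite -(lebesgue_measure_translation c (mI j)); congr (mu _).
  by apply/seteqP; split=> t; rewrite /= ij.
have per (i j : interval R) :
    (forall t, (t \in i) = (t + 1 \in j)) -> mu (E `&` [set` i]) = mu (E `&` [set` j]).
  move=> ij; rewrite -(shift _ _ 1 ij); congr (mu (_ `&` _)).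
  by apply/seteqP; split=> t; rewrite /E/= -[1]/(1%:R) fracDn.
rewrite !circle_measureE -[rot r @^-1` A]/((fun t => t + r) @^-1` E).
rewrite (shift _ `[r, 1 + r[ r); last by move=> t; rewrite !in_itv/=; lra.
have split3 (a b c : R) : a <= b <= c ->
    mu (E `&` `[a, c[) = (mu (E `&` `[a, b[) + mu (E `&` `[b, c[))%E.
  move=> abc; rewrite -measureU; [|exact: mI|exact: mI|].
    rewrite -setIUr; congr (mu (_ `&` _)).
    by apply/seteqP; split=> t /=; rewrite !in_itv/=; lra.
  by apply/seteqP; split=> t //= -[[_ +] [_]]; rewrite !in_itv/=; lra.
rewrite (split3 r 1) ?(split3 0 r 1) 1?addeC; [|lra..].
by congr (_ + _)%E; apply/esym/per => t; rewrite !in_itv/=; lra.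
Qed.

End Circle.

(** * The torus, its skew products and its translations *)

Section Torus.
Context (R : realType).
Local Notation torus := (measurableTypeR R * measurableTypeR R)%type.

Definition torus_measure : set torus -> \bar R :=
  (@circle_measure R \x @circle_measure R)%E.

HB.instance Definition _ := Measure.on torus_measure.

Lemma torus_measureX (A B : set R) : measurable A -> measurable B ->
  torus_measure (A `*` B) = (circle_measure A * circle_measure B)%E.
Proof. by move=> mA mB; exact: product_measure1E. Qed.

Lemma torus_setT : torus_measure [set: torus] = 1%E.
Proof. by rewrite -setXTT torus_measureX// circle_setT mule1. Qed.

HB.instance Definition _ :=
  Measure_isProbability.Build _ _ R torus_measure torus_setT.

Definition torus_prob : probability torus R := torus_measure.
Local Notation nu := torus_prob.

(** With [k = id] this is the transformation of the counterexample; with a constant [k] it is a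
    vertical translation, such as the half turn. *)
Definition skew (k : R -> R) (y : torus) : torus := (y.1, rot (k y.1) y.2).

Definition translate (a b : R) (y : torus) : torus := (rot a y.1, rot b y.2).

Lemma measurable_skew k : measurable_fun [set: R] k ->
  measurable_fun [set: torus] (skew k).
Proof.
move=> mk; apply: measurable_fun_pair => //.
apply: (measurableT_comp (@measurable_frac R)).
by apply: measurable_funD => //; exact: measurableT_comp.
Qed.

Lemma measurable_translate a b : measurable_fun [set: torus] (translate a b).
Proof.
by apply: measurable_fun_pair; apply: (measurableT_comp (@measurable_rot R _)).
Qed.

(** Fubini: the section over [x] is rotated by [k x], which keeps its circle measure. *)
Lemma skew_preserving k : measurable_fun [set: R] k ->
  measure_preserving nu (skew k).
Proof.
move=> mk; split; first exact: measurable_skew.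
move=> C mC; apply: eq_integral => x _ /=.
rewrite -(circle_rot (k x) (measurable_xsection x mC)); congr circle_measure.
Qed.

(** A product measure is determined by its values on rectangles, and the preimage of a rectangle is
    the rectangle of the rotated sides. *)
Lemma translate_preserving a b : measure_preserving nu (translate a b).
Proof.
split; first exact: measurable_translate.
move=> C mC; apply/esym.
pose f := translate a b.
have mf : measurable_fun [set: torus] f by exact: measurable_translate.
pose mf_mixin := isMeasurableFun.Build _ _ _ _ _ mf.
pose mf_pack : {mfun _ >-> _} := HB.pack f mf_mixin.
apply: (@product_measure_unique _ _ _ _ _ _ _ (pushforward nu mf_pack)) => //.
move=> A B mA mB /=; rewrite -[LHS]/(nu (f @^-1` (A `*` B))).
have -> : f @^-1` (A `*` B) = (rot a @^-1` A) `*` (rot b @^-1` B) by [].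
rewrite [LHS]torus_measureX; first by rewrite !circle_rot.
- by rewrite -[_ @^-1` _]setTI; exact: measurable_rot.
- by rewrite -[_ @^-1` _]setTI; exact: measurable_rot.
Qed.

Lemma ae_frac_snd : {ae nu, forall y, frac y.2 = y.2}.
Proof.
exists (setT `*` ~` `[0, 1[%classic); split.
- by apply: measurableX => //; exact: measurableC.
- rewrite [LHS]torus_measureX//; last exact: measurableC.
  by rewrite [X in (_ * X)%E]circle_measureE setICl measure0 mule0.
- move=> y /= ny; split=> // y01; apply: ny.
  by apply: frac_id; move: y01; rewrite in_itv.
Qed.

(** The first coordinate is invariant, so the vertical strip over [[0, 1/2[] is an invariant set of
    measure 1/2. *)
Lemma skew_id_not_ergodic : ~ ergodic nu (skew id).
Proof.
pose A : set R := `[0, 1/2[%classic.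
have /= mA : measurable A by exact: measurable_itv.
have cA : circle_measure A = (1/2)%:E.
  rewrite circle_measureE (_ : _ `&` _ = A).
    by rewrite lebesgue_measure_itv/= lte_fin ltr_pdivlMr// mul0r ltr01 sube0.
  by apply/seteqP; split=> t; rewrite /A/= !in_itv/=; lra.
have nuA : nu (A `*` setT) = (1/2)%:E.
  by rewrite [LHS]torus_measureX// cA [X in (_ * X)%E]circle_setT mule1.
move=> /(_ (A `*` setT)); rewrite nuA => /(_ _ _)[||[]|[]] //.
- exact: measurableX.
- by clear => half; lra.
- by clear => half; lra.
Qed.

End Torus.

(** * Integrals under measure preserving maps *)

Section ChangeOfVariables.
Context (R : realType) (d : measure_display) (T : measurableType d).
Context (mu : probability T R).

Lemma ae_imply (P Q : T -> Prop) : (forall x, P x -> Q x) ->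
  {ae mu, forall x, P x} -> {ae mu, forall x, Q x}.
Proof. by move=> PQ; exact: filterS. Qed.

Lemma ae_eq_Rintegral (u v : T -> R) :
  measurable_fun [set: T] u -> measurable_fun [set: T] v ->
  {ae mu, forall x, u x = v x} -> \int[mu]_x u x = \int[mu]_x v x.
Proof.
move=> mu_ mv uv; congr fine; apply: ae_eq_integral => //.
- exact/measurable_EFinP.
- exact/measurable_EFinP.
- by apply: filterS uv => x uvx _; rewrite uvx.
Qed.

Section Preserving.
Context (S : T -> T) (pS : measure_preserving mu S).

Lemma ge0_integral_preserving (u : T -> \bar R) :
  measurable_fun [set: T] u -> (forall x, 0 <= u x)%E ->
  (\int[mu]_x u (S x) = \int[mu]_x u x)%E.
Proof.
case: pS => mS eS mu_ u0.
rewrite -[LHS](@ge0_integral_pushforward _ _ _ _ _ S mS mu setT)//.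
pose mS_mixin := isMeasurableFun.Build _ _ _ _ _ mS.
pose mS_pack : {mfun _ >-> _} := HB.pack S mS_mixin.
by apply: (@eq_measure_integral _ _ _ _ mu (pushforward mu mS_pack)) => A mA _;
   exact: eS.
Qed.

Lemma integral_preserving (u : T -> R) : measurable_fun [set: T] u ->
  (\int[mu]_x (u (S x))%:E = \int[mu]_x (u x)%:E)%E.
Proof.
move=> mu_.
have mu' : measurable_fun [set: T] (EFin \o u).
  exact/measurable_EFinP.
rewrite -[LHS]/(\int[mu]_x ((EFin \o u) \o S) x)%E integralE [RHS]integralE.
rewrite funepos_comp funeneg_comp; congr (_ - _)%E.
- by apply: ge0_integral_preserving => //; exact: measurable_funepos.
- by apply: ge0_integral_preserving => //; exact: measurable_funeneg.
Qed.

Lemma Rintegral_preserving (u : T -> R) : measurable_fun [set: T] u ->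
  \int[mu]_x u (S x) = \int[mu]_x u x.
Proof. by move=> mu_; rewrite /Rintegral integral_preserving. Qed.

(** Up to a null set, [S] exchanges the positive and negative parts of [u], which therefore have
    equal integrals. *)
Lemma integral_odd (u : T -> R) : measurable_fun [set: T] u ->
  {ae mu, forall x, u (S x) = - u x} -> \int[mu]_x u x = 0.
Proof.
move=> mu_ uN.
have mu' : measurable_fun [set: T] (EFin \o u).
  exact/measurable_EFinP.
have mS := pS.1.
rewrite /Rintegral integralE.
suff -> : (\int[mu]_x (EFin \o u)^\- x = \int[mu]_x (EFin \o u)^\+ x)%E.
  have : (0 <= \int[mu]_x (EFin \o u)^\+ x)%E by exact: integral_ge0.
  (* If the common value is infinite, so is the difference, and [fine] sends it to 0. *)
  by case: (integral _ _ _) => //= r _; rewrite subrr.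
rewrite -(@ge0_integral_preserving (EFin \o u)^\-%E)//; last exact: measurable_funeneg.
apply: ae_eq_integral => //.
- by apply: measurableT_comp mS; exact: measurable_funeneg.
- exact: measurable_funepos.
- by apply: filterS uN => x ux _; rewrite funeposE funenegE/= ux opprK.
Qed.

End Preserving.
End ChangeOfVariables.

(** * Bessel's inequality for bounded orthogonal functions *)

Section Bessel.
Context (R : realType) (d : measure_display) (T : measurableType d).
Context (mu : probability T R).
Local Notation integrable f := (mu.-integrable [set: T] (EFin \o f)).

Definition bounded_measurable (f : T -> R) :=
  measurable_fun [set: T] f /\ exists M, forall x, `|f x| <= M.

Lemma bounded_measurableD f g : bounded_measurable f -> bounded_measurable g ->
  bounded_measurable (fun x => f x + g x).
Proof.
move=> [mf [M fM]] [mg [N gN]]; split; first exact: measurable_funD.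
by exists (M + N) => x; rewrite (le_trans (ler_normD _ _))// lerD.
Qed.

Lemma bounded_measurableM f g : bounded_measurable f -> bounded_measurable g ->
  bounded_measurable (fun x => f x * g x).
Proof.
move=> [mf [M fM]] [mg [N gN]]; split; first exact: measurable_funM.
by exists (M * N) => x; rewrite normrM ler_pM.
Qed.

Lemma bounded_measurable_cst c : bounded_measurable (fun=> c).
Proof. by split; [exact: measurable_cst|exists `|c|]. Qed.

Lemma bounded_funP (f : T -> R) M : (forall x, `|f x| <= M) ->
  [bounded f x | x in [set: T]].
Proof.
by move=> fM; exists M; split=> [|r Mr x _]; [exact: num_real|exact: le_trans (ltW Mr)].
Qed.

Lemma integrable_bounded f : bounded_measurable f -> integrable f.
Proof.
move=> [mf [M fM]]; apply: measurable_bounded_integrable => //.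
- exact: fin_num_fun_lty.
- exact: bounded_funP fM.
Qed.

Lemma integrable_mul_bounded P f : integrable P -> bounded_measurable f ->
  integrable (fun x => P x * f x).
Proof.
move=> iP [mf [M fM]].
have := @integrableMl _ _ _ mu setT measurableT _ f iP mf (bounded_funP fM).
exact: eq_integrable.
Qed.

Context (F : nat -> T -> R).
Hypothesis mF : forall n, measurable_fun [set: T] (F n).
Hypothesis F1 : forall n x, `|F n x| <= 1.
Hypothesis orthoF : forall m n, (n < m)%N -> \int[mu]_x (F n x * F m x) = 0.

Let bF n : bounded_measurable (F n).
Proof. by split=> //; exists 1. Qed.

(** The nonnegative integral of [(P x - Q N x) ^+ 2] is expanded, [Q N] being the sum of the
    [c n * F n]. The [F n] are not normalised, but their bound by 1 makes the integral of [F n ^+ 2]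
    at most 1, which is the direction required. *)
Lemma bessel (P : T -> R) : integrable P -> integrable (fun x => P x ^+ 2) ->
  forall N, \sum_(n < N) (\int[mu]_x (P x * F n x)) ^+ 2 <= \int[mu]_x (P x ^+ 2).
Proof.
move=> iP iP2 N; pose c n := \int[mu]_x (P x * F n x).
pose Q N x := \sum_(n < N) c n * F n x.
have QS n : Q n.+1 = fun x => Q n x + c n * F n x.
  by apply/funext => x; rewrite /Q big_ord_recr.
have bcF n : bounded_measurable (fun x => c n * F n x).
  by apply: bounded_measurableM => //; exact: bounded_measurable_cst.
have bQ n : bounded_measurable (Q n).
  elim: n => [|n IH]; last by rewrite QS; exact: bounded_measurableD.
  have -> : Q 0 = fun=> 0 by apply/funext => x; rewrite /Q big_ord0.
  exact: bounded_measurable_cst.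
have iPF n : integrable (fun x => P x * F n x) by exact: integrable_mul_bounded.
(* [Q n] involves only the indices below [n]. *)
have orthoQ n m : (n <= m)%N -> \int[mu]_x (Q n x * F m x) = 0.
  elim: n => [|n IH] nm.
    under eq_Rintegral do rewrite /Q big_ord0 mul0r.
    by rewrite Rintegral_cst// mul0r.
  under eq_Rintegral do rewrite QS mulrDl -mulrA.
  rewrite RintegralD//; last 2 first.
  - by apply: integrable_bounded; exact: bounded_measurableM.
  - apply: integrable_bounded; apply: bounded_measurableM => //.
      exact: bounded_measurable_cst.
    exact: bounded_measurableM.
  rewrite IH ?(ltnW nm)// RintegralZl// ?orthoF// ?mulr0 ?addr0//.
  by apply: integrable_bounded; exact: bounded_measurableM.
have PQ n : \int[mu]_x (P x * Q n x) = \sum_(k < n) c k ^+ 2.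
  elim: n => [|n IH].
    under eq_Rintegral do rewrite /Q big_ord0 mulr0.
    by rewrite big_ord0 Rintegral_cst// mul0r.
  under eq_Rintegral do rewrite QS mulrDr mulrCA.
  rewrite RintegralD//; last 2 first.
  - exact: integrable_mul_bounded.
  - have := integrable_mul_bounded iP (bcF n).
    by apply: eq_integrable => // x _ /=; rewrite mulrCA.
  by rewrite IH RintegralZl// big_ord_recr.
(* The cross term vanishes by [orthoQ], and the new square contributes at most [c n ^+ 2]. *)
have QQ n : \int[mu]_x (Q n x ^+ 2) <= \sum_(k < n) c k ^+ 2.
  elim: n => [|n IH].
    under eq_Rintegral do rewrite /Q big_ord0 expr0n/=.
    by rewrite big_ord0 Rintegral_cst// mul0r.
  under eq_Rintegral.
    move=> x _; rewrite QS (_ : _ ^+ 2 = Q n x ^+ 2 + 2 * c n * (Q n x * F n x)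
      + c n ^+ 2 * (F n x ^+ 2)); last by ring.
    over.
  have b1 : bounded_measurable (fun x => Q n x ^+ 2).
    by have := bounded_measurableM (bQ n) (bQ n).
  have b2 : bounded_measurable (fun x => Q n x * F n x).
    exact: bounded_measurableM.
  have b3 : bounded_measurable (fun x => F n x ^+ 2).
    by have := bounded_measurableM (bF n) (bF n).
  have b2c : bounded_measurable (fun x => 2 * c n * (Q n x * F n x)).
    by apply: bounded_measurableM => //; exact: bounded_measurable_cst.
  have b3c : bounded_measurable (fun x => c n ^+ 2 * (F n x ^+ 2)).
    by apply: bounded_measurableM => //; exact: bounded_measurable_cst.
  rewrite RintegralD//; last 2 first.
  - by apply: integrable_bounded; exact: bounded_measurableD.
  - exact: integrable_bounded.
  rewrite RintegralD//; last 2 first.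
  - exact: integrable_bounded.
  - exact: integrable_bounded.
  rewrite RintegralZl//; last exact: integrable_bounded.
  rewrite orthoQ// mulr0 addr0 RintegralZl//; last exact: integrable_bounded.
  rewrite big_ord_recr/= lerD// ler_piMr ?sqr_ge0//.
  apply: (@le_trans _ _ (\int[mu]_x (cst 1 : T -> R) x)).
    apply: le_Rintegral => //.
    + exact: integrable_bounded.
    + by apply: integrable_bounded; exact: bounded_measurable_cst.
    + by move=> x _ /=; rewrite -[leLHS]real_normK ?num_real// expr_le1.
  by rewrite Rintegral_cst// mul1r -[leRHS]/(fine 1%E) -(probability_setT mu).
have : 0 <= \int[mu]_x ((P x - Q N x) ^+ 2).
  by apply: Rintegral_ge0 => x _; exact: sqr_ge0.
under eq_Rintegral.
  move=> x _; rewrite (_ : _ ^+ 2 = P x ^+ 2 - 2 * (P x * Q N x) + Q N x ^+ 2);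
    last by ring.
  over.
have i2 : integrable (fun x => 2 * (P x * Q N x)).
  have := integrable_mul_bounded iP
    (bounded_measurableM (bounded_measurable_cst 2) (bQ N)).
  by apply: eq_integrable => // x _ /=; rewrite mulrCA.
have i3 : integrable (fun x => Q N x ^+ 2).
  by apply: integrable_bounded; have := bounded_measurableM (bQ N) (bQ N).
rewrite RintegralD//; last first.
  by have := integrableB measurableT iP2 i2; exact: eq_integrable.
rewrite RintegralB// RintegralZl//; last exact: integrable_mul_bounded.
by have := QQ N; rewrite PQ; lra.
Qed.

End Bessel.

(** * Correlations of an eigenfunction with an orthogonal orbit *)

Section EigenpairCorrelations.
Context (R : realType) (d : measure_display) (T : measurableType d).
Context (mu : probability T R) (S : T -> T) (pS : measure_preserving mu S).
Local Notation integrable f := (mu.-integrable [set: T] (EFin \o f)).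
Context (F : nat -> T -> R).
Hypothesis mF : forall n, measurable_fun [set: T] (F n).
Hypothesis F1 : forall n x, `|F n x| <= 1.
Hypothesis orthoF : forall m n, (n < m)%N -> \int[mu]_x (F n x * F m x) = 0.
Hypothesis FS : forall n x, F n (S x) = F n.+1 x.

(* [p + i q] is an eigenfunction with eigenvalue [a + i b]. *)
Lemma eigenpair_correlation (p q : T -> R) (a b : R) :
  integrable p -> integrable (fun x => p x ^+ 2) ->
  integrable q -> integrable (fun x => q x ^+ 2) ->
  a ^+ 2 + b ^+ 2 = 1 ->
  {ae mu, forall x, p (S x) = a * p x - b * q x} ->
  {ae mu, forall x, q (S x) = b * p x + a * q x} ->
  \int[mu]_x (p x * F 0 x) = 0.
Proof.
move=> ip ip2 iq iq2 ab1 pSE qSE.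
have bF n : bounded_measurable (F n) by split=> //; exists 1.
have [/measurable_EFinP mp /measurable_EFinP mq] :=
  (measurable_int _ ip, measurable_int _ iq).
pose x n := \int[mu]_t (p t * F n t); pose y n := \int[mu]_t (q t * F n t).
have ipF n : integrable (fun t => p t * F n t) by exact: integrable_mul_bounded.
have iqF n : integrable (fun t => q t * F n t) by exact: integrable_mul_bounded.
(* Composing with [S] keeps the integral, moves [F n] to [F n.+1] and replaces [r] by its
   combination of [p] and [q]. *)
have lin (c e : R) (r : T -> R) n : integrable r ->
    {ae mu, forall t, r (S t) = c * p t + e * q t} ->
    \int[mu]_t (r t * F n t) = c * x n.+1 + e * y n.+1.
  move=> ir rS; have /measurable_EFinP mr := measurable_int _ ir.
  have mrF : measurable_fun [set: T] (fun t => r t * F n t).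
    exact: measurable_funM.
  rewrite -(Rintegral_preserving pS mrF).
  transitivity (\int[mu]_t (c * (p t * F n.+1 t) + e * (q t * F n.+1 t))).
    apply: ae_eq_Rintegral.
    - exact: (measurableT_comp mrF pS.1).
    - by apply: measurable_funD; apply: measurable_funM => //; exact: measurable_funM.
    - by apply: filterS rS => t ->; rewrite FS; ring.
  have icp := integrableZl measurableT c (ipF n.+1).
  have icq := integrableZl measurableT e (iqF n.+1).
  by rewrite RintegralD// !RintegralZl.
have xE n : x n = a * x n.+1 - b * y n.+1.
  by rewrite -mulNr; apply: lin => //; apply: filterS pSE => t ->; rewrite mulNr.
have yE n : y n = b * x n.+1 + a * y n.+1 by exact: lin.
(* The correlation [x n + i y n] is the next one multiplied by [a + i b], of modulus 1, so its
   modulus does not depend on [n]. *)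
have xy n : x n ^+ 2 + y n ^+ 2 = x 0%N ^+ 2 + y 0%N ^+ 2.
  elim: n => // n <-; rewrite (xE n) (yE n).
  transitivity ((a ^+ 2 + b ^+ 2) * (x n.+1 ^+ 2 + y n.+1 ^+ 2)); last by ring.
  by rewrite ab1 mul1r.
pose M := \int[mu]_t (p t ^+ 2) + \int[mu]_t (q t ^+ 2).
(* Bessel's inequality for [p] and for [q] bounds a sum of [N] equal terms by a constant. *)
have leM N : N%:R * (x 0%N ^+ 2 + y 0%N ^+ 2) <= M.
  have -> : N%:R * (x 0%N ^+ 2 + y 0%N ^+ 2) = \sum_(n < N) (x n ^+ 2 + y n ^+ 2).
    by under eq_bigr do rewrite xy; rewrite sumr_const card_ord mulr_natl.
  by rewrite big_split lerD//; exact: bessel.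
have M0 : 0 <= M by rewrite (le_trans _ (leM 0%N))// mul0r.
suff : x 0%N ^+ 2 + y 0%N ^+ 2 <= 0.
  rewrite -/(x 0%N) => xy0; apply/eqP; rewrite -sqrf_eq0 eq_le sqr_ge0 andbT.
  by rewrite (le_trans _ xy0)// lerDl sqr_ge0.
rewrite leNgt; apply/negP => xy_gt0.
(* An index larger than the quotient, so that [leM] fails at it. *)
have := leM (Num.truncn (M / (x 0%N ^+ 2 + y 0%N ^+ 2))).+1.
by rewrite leNgt -ltr_pdivrMr// truncnS_gt.
Qed.

End EigenpairCorrelations.

(** * Invariance of eigenfunctions under the half turn *)

Section TorusEigenpairs.
Context (R : realType).
Local Notation torus := (measurableTypeR R * measurableTypeR R)%type.
Local Notation nu := (torus_prob R).
Local Notation integrable f := (nu.-integrable [set: torus] (EFin \o f)).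

Definition half_turn : torus -> torus := skew (cst (1 / 2)).

(** This is the function psi. Building it from an indicator, for arbitrary [B], lets the
    correlations determine integrals over rectangles. *)
Definition square_wave (B : set R) (x : R) : R :=
  \1_B (frac x) - \1_B (frac (x + 1 / 2)).

Lemma square_waveDz B x (k : int) : square_wave B (x + k%:~R) = square_wave B x.
Proof. by rewrite /square_wave fracDz addrAC fracDz. Qed.

Lemma square_waveD_half B x : square_wave B (x + 1 / 2) = - square_wave B x.
Proof.
rewrite /square_wave -addrA (_ : 1 / 2 + 1 / 2 = 1%:R); last by field.
by rewrite fracDn opprB.
Qed.

Lemma square_wave_le1 B x : `|square_wave B x| <= 1.
Proof.
rewrite /square_wave !indicE.
by do 2 case: (_ \in _); rewrite ?subr0 ?sub0r ?subrr ?normrN ?normr1 ?normr0.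
Qed.

Lemma measurable_square_wave B : measurable B ->
  measurable_fun [set: R] (square_wave B).
Proof.
move=> mB; have mI : measurable_fun [set: R] (fun x => \1_B (frac x) : R).
  by apply: measurableT_comp (@measurable_frac R); exact: measurable_indic.
apply: measurable_funB; first exact: mI.
exact: measurableT_comp mI (measurable_addr (1 / 2)).
Qed.

(** The orthogonal family [psi(t + n alpha)], indexed along an orbit. *)
Definition wave (B : set R) (n : nat) (y : torus) : R :=
  square_wave B (y.2 + n%:R * y.1).

Lemma measurable_wave B n : measurable B -> measurable_fun [set: torus] (wave B n).
Proof.
move=> mB; apply: (measurableT_comp (measurable_square_wave mB)).
by apply: measurable_funD => //; exact: measurable_funM.
Qed.

Lemma wave_skew B n y : wave B n (skew id y) = wave B n.+1 y.
Proof.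
rewrite /wave /skew/= /rot; have [k ->] := fracE (y.2 + y.1).
by rewrite addrAC square_waveDz mulrSr mulrDl mul1r addrAC addrA.
Qed.

Lemma wave_translate B n a b y :
  wave B n (translate a b y) = square_wave B (y.2 + n%:R * y.1 + (b + n%:R * a)).
Proof.
rewrite /wave /translate /rot/=.
have [[k ->] [l ->]] := (fracE (y.2 + b), fracE (y.1 + a)).
(* The two reductions modulo 1 change the argument by the integer [k + n l]. *)
rewrite -(square_waveDz _ (_ + (b + _)) (k + n%:Z * l)); congr square_wave.
by rewrite intrD intrM; ring.
Qed.

Lemma wave_orthogonal B m n : measurable B -> (n < m)%N ->
  \int[nu]_y (wave B n y * wave B m y) = 0.
Proof.
(* This translation fixes [wave B n] and moves the argument of [wave B m] by a
   half turn. *)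
move=> mB nm; pose a : R := (2 * (m%:R - n%:R))^-1; pose b := - (n%:R * a).
apply: (integral_odd (translate_preserving a b)).
  by apply: measurable_funM; exact: measurable_wave.
apply: aeW => y; rewrite !wave_translate /b addNr addr0.
have -> : - (n%:R * a) + m%:R * a = 1 / 2.
  by rewrite /a; field; rewrite subr_eq0 eqr_nat gtn_eqF.
by rewrite square_waveD_half mulrN.
Qed.

(** The difference [h] of the two sides has integral 0 over every rectangle, hence over every
    measurable set by a Dynkin argument, so it vanishes almost everywhere. *)
Lemma ae_half_turn_of_eigenpair (p q : torus -> R) (a b : R) :
  integrable p -> integrable (fun x => p x ^+ 2) ->
  integrable q -> integrable (fun x => q x ^+ 2) ->
  a ^+ 2 + b ^+ 2 = 1 ->
  {ae nu, forall y, p (skew id y) = a * p y - b * q y} ->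
  {ae nu, forall y, q (skew id y) = b * p y + a * q y} ->
  {ae nu, forall y, p (half_turn y) = p y}.
Proof.
move=> ip ip2 iq iq2 ab1 pSE qSE.
have /measurable_EFinP mp := measurable_int _ ip.
have pS : measure_preserving nu (skew id) by exact: skew_preserving.
have pH : measure_preserving nu half_turn by exact: skew_preserving.
have mpH : measurable_fun [set: torus] (p \o half_turn).
  exact: (measurableT_comp mp pH.1).
have ipH : integrable (p \o half_turn).
  apply/integrableP; split; first exact/measurable_EFinP.
  have /integrableP[_] := ip; congr (_ < +oo)%E; apply/esym.
  apply: (ge0_integral_preserving pH (u := fun y => `|(p y)%:E|%E)) => //.
  by apply/measurableT_comp => //; exact/measurable_EFinP.
pose h y := p (half_turn y) - p y.
have ih : integrable h by have := integrableB measurableT ipH ip; exact: eq_integrable.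
have mh : measurable_fun [set: torus] h by exact: measurable_funB.
have rect (A B : set R) : measurable A -> measurable B ->
    \int[nu]_(y in A `*` B) h y = 0.
  move=> mA mB.
  pose w (y : torus) : R := \1_A y.1 * \1_B (frac y.2).
  have mA1 : measurable_fun [set: torus] (fun y => \1_A y.1 : R).
    by apply: measurableT_comp => //; exact: measurable_indic.
  have mw : measurable_fun [set: torus] w.
    apply: measurable_funM => //.
    apply: (@measurableT_comp _ _ _ _ _ _ (\1_B : R -> R)).
      exact: measurable_indic.
    exact: measurableT_comp (@measurable_frac R) _.
  have mwH := measurableT_comp mw pH.1.
  have bA : bounded_measurable (fun y : torus => \1_A y.1 : R).
    split=> //; exists 1 => y; rewrite indicE.
    by case: (_ \in _); rewrite ?normr1 ?normr0.
  have bw : bounded_measurable w.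
    split=> //; exists 1 => y; rewrite /w !indicE.
    by do 2 case: (_ \in _); rewrite ?mulr0 ?mul0r ?mulr1 ?normr1 ?normr0.
  have bwH : bounded_measurable (w \o half_turn).
    by split=> //; have [_ [M wM]] := bw; exists M => y; exact: wM.
  (* Two half turns change the second coordinate by an integer, which [frac] forgets. *)
  have halfK y : w (half_turn (half_turn y)) = w y.
    rewrite /w /half_turn /skew /rot/=; congr (_ * \1_B _).
    have [k ->] := fracE (y.2 + 1 / 2).
    rewrite frac_frac (_ : _ + 1 / 2 = y.2 + (k + 1)%:~R) ?fracDz//.
    by rewrite intrD; field.
  (* The first coordinate is invariant under [skew id], so multiplying [p] and [q] by the indicator
     of [A] keeps the eigenvalue relations. *)
  have : \int[nu]_y (p y * \1_A y.1 * wave B 0 y) = 0.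
    apply: (@eigenpair_correlation _ _ _ nu (skew id) pS (wave B) _ _ _ _
      (fun y => p y * \1_A y.1) (fun y => q y * \1_A y.1) a b) => //.
    - by move=> n; exact: measurable_wave.
    - by move=> n y; exact: square_wave_le1.
    - by move=> m n; exact: wave_orthogonal.
    - by move=> n y; exact: wave_skew.
    - exact: integrable_mul_bounded.
    - have := integrable_mul_bounded ip2 (bounded_measurableM bA bA).
      by apply: eq_integrable => // y _ /=; rewrite exprMn.
    - exact: integrable_mul_bounded.
    - have := integrable_mul_bounded iq2 (bounded_measurableM bA bA).
      by apply: eq_integrable => // y _ /=; rewrite exprMn.
    - by apply: filterS pSE => y ->; rewrite /=; ring.
    - by apply: filterS qSE => y ->; rewrite /=; ring.
  have E y : p y * \1_A y.1 * wave B 0 y = p y * w y - p y * (w \o half_turn) y.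
    rewrite /wave /square_wave /w /half_turn /skew /rot/= mul0r addr0.
    by rewrite frac_frac; ring.
  under eq_Rintegral do rewrite E.
  rewrite RintegralB//; [|exact: integrable_mul_bounded..].
  move/eqP; rewrite subr_eq0 => /eqP pw.
  (* The half turn preserves [nu] and is an involution for [w], so it can be moved from [w] to [p]
     under the integral. *)
  have : \int[nu]_y (h y * w y) = 0.
    under eq_Rintegral do rewrite mulrBl.
    rewrite RintegralB//; [|exact: integrable_mul_bounded..].
    rewrite pw -(Rintegral_preserving pH (u := fun y => p y * (w \o half_turn) y)).
      by under [X in _ - X]eq_Rintegral do rewrite /= halfK; rewrite subrr.
    exact: measurable_funM.
  move=> <-; rewrite Rintegral_mkcond.
  have -> : h \_ (A `*` B) = fun y => h y * \1_(A `*` B) y.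
    by apply/funext => y; rewrite patchE indicE; case: (_ \in _); rewrite ?mulr1 ?mulr0.
  apply: ae_eq_Rintegral.
  - by apply: measurable_funM => //; apply: measurable_indic; exact: measurableX.
  - exact: measurable_funM.
  (* [w] is built on [frac y.2], the indicator of the rectangle on [y.2]; they agree over [[0,
     1[]. *)
  - apply: (ae_imply (mu := nu) _ (ae_frac_snd R)) => y fy; congr (_ * _).
    by rewrite /w fy !indicE in_setX -natrM mulnb.
have ihD (D : set torus) : measurable D -> nu.-integrable D (EFin \o h).
  by move=> mD; exact: (integrableS measurableT mD (@subsetT _ D) ih).
(* Rectangles form a pi-system generating the product sigma-algebra. Complements are handled by the
   zero integral over the whole space. *)
have all0 : forall D, measurable D -> \int[nu]_(y in D) h y = 0.
  rewrite measurable_prod_measurableType.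
  apply: (dynkin_induction (P := fun D => \int[nu]_(y in D) h y = 0)).
  - exact: measurable_prod_measurableType.
  - move=> _ _ [A1 mA1 [B1 mB1 <-]] [A2 mA2 [B2 mB2 <-]].
    exists (A1 `&` A2); first exact: measurableI.
    by exists (B1 `&` B2); [exact: measurableI|rewrite setXI].
  - by rewrite -setXTT; exact: rect.
  - by move=> _ [A mA [B mB <-]]; exact: rect.
  - move=> D mD D0; have : \int[nu]_y h y = 0 by rewrite -setXTT; exact: rect.
    have := @Rintegral_setU _ _ _ nu D (~` D) h mD (measurableC mD).
    rewrite setUv D0 add0r => ->//.
    by rewrite /disj_set setICr.
  - move=> D mD tD D0; rewrite /Rintegral integral_bigcup//; last first.
      by apply: ihD => //; exact: bigcupT_measurable.
    rewrite eseries0// => n _ _.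
    have fin := integrable_fin_num (mD n) (ihD _ (mD n)).
    by rewrite -(fineK fin) [fine _]D0.
have : ae_eq nu setT (EFin \o h) (cst 0%E).
  apply: integral_ae_eq => // D _ mD.
  rewrite integral0 -(fineK (integrable_fin_num mD (ihD _ mD))).
  by rewrite [fine _]all0.
by apply: filterS => y /(_ I)[] /eqP; rewrite subr_eq0 => /eqP.
Qed.

End TorusEigenpairs.

(** * From invariant eigenfunctions to the Kronecker sigma-algebra *)

Section AlmostInvariance.
Context (R : realType) (d : measure_display) (T : measurableType d).
Context (mu : probability T R) (H : T -> T).

Definition ae_invariant_sets : set (set T) :=
  [set A | {ae mu, forall x, A (H x) <-> A x}].

Lemma sigma_algebra_ae_invariant_sets : sigma_algebra setT ae_invariant_sets.
Proof.
split.
- exact: aeW.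
- by move=> A; apply: ae_imply => x Ax; rewrite setTD /setC/= Ax.
- move=> A /ae_foralln; apply: ae_imply => x Ax.
  by split=> -[n _ /Ax ?]; exists n.
Qed.

(** If the two values differed, a rational would separate them; countably many rays suffice, so the
    exceptional sets have a null union. *)
Lemma ae_invariant_fun (u : T -> R) :
  (forall B : set R, measurable B -> ae_invariant_sets (u @^-1` B)) ->
  {ae mu, forall x, u (H x) = u x}.
Proof.
(* Rays with rational endpoints, enumerated through [unpickle]; [setT] is the default for numbers
   that code no rational. *)
move=> uB; pose B n : set R :=
  if unpickle n is Some q then [set` `]-oo, (ratr q : R)[] else setT.
have mB n : measurable (B n) by rewrite /B; case: unpickle.
have := ae_foralln (fun n => uB _ (mB n)); apply: ae_imply => x Bx.
have Bq (q : rat) : (u (H x) < ratr q) = (u x < ratr q).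
  have := Bx (pickle q); rewrite /B pickleK /= !in_itv/= => -[xHx Hxx].
  by apply/idP/idP.
apply/eqP; rewrite eq_le !leNgt; apply/andP; split; apply/negP => uu;
  have [q] := rat_in_itvoo uu; rewrite in_itv/= => /andP[q1 q2].
- by move: q1; rewrite -Bq => /(lt_trans q2); rewrite ltxx.
- by move: q1; rewrite Bq => /(lt_trans q2); rewrite ltxx.
Qed.

(** The almost invariant sets form a sigma-algebra containing the generators, hence all of
    [<<s eigen_sets mu S >>]. *)
Lemma kronecker_measurable_ae_invariant (S : T -> T) :
  (forall g, eigenfunction mu S g -> {ae mu, forall x, g (H x) = g x}) ->
  forall f, kronecker_measurable mu S f ->
  {ae mu, forall x, complex.Re (f (H x)) = complex.Re (f x)} /\
  {ae mu, forall x, complex.Im (f (H x)) = complex.Im (f x)}.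
Proof.
move=> eigH f [mRe mIm].
have eigen_invariant : <<s eigen_sets mu S >> `<=` ae_invariant_sets.
  apply: smallest_sub; first exact: sigma_algebra_ae_invariant_sets.
  move=> A [g [B [eg mB [->|->]]]];
  by apply: ae_imply (eigH g eg) => x gx; rewrite /preimage/= gx.
split; apply: ae_invariant_fun => B mB; apply: eigen_invariant.
- by have := mRe measurableT B mB; rewrite setTI.
- by have := mIm measurableT B mB; rewrite setTI.
Qed.

End AlmostInvariance.

(** * Square integrable functions and the modulus of eigenvalues *)

Section SquareIntegrability.
Context (R : realType) (d : measure_display) (T : measurableType d).
Context (mu : probability T R).
Local Notation integrable f := (mu.-integrable [set: T] (EFin \o f)).

Lemma sqr_Re_norm (z : R[i]) :
  complex.Re `|z| ^+ 2 = complex.Re z ^+ 2 + complex.Im z ^+ 2.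
Proof. by rewrite normc_def /= sqr_sqrtr// addr_ge0 ?sqr_ge0. Qed.

(** [|u|] is at most [u^2 + 1], and constants are integrable for a probability. *)
Lemma integrable_of_sqr (u : T -> R) : measurable_fun [set: T] u ->
  integrable (fun x => u x ^+ 2) -> integrable u.
Proof.
move=> mu_ iu2.
have i1 := integrableD measurableT iu2
  (integrable_bounded mu (bounded_measurable_cst T 1)).
apply: le_integrable i1 => //; first exact/measurable_EFinP.
move=> x _ /=; rewrite lee_fin [leRHS]ger0_norm ?addr_ge0 ?sqr_ge0//.
by rewrite -(real_normK (num_real (u x))); have := normr_ge0 (u x); nra.
Qed.

Lemma in_L2_integrable (g : T -> R[i]) : in_Lp mu 2%:E g ->
  [/\ integrable (fun x => complex.Re (g x) ^+ 2),
      integrable (fun x => complex.Im (g x) ^+ 2),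
      integrable (fun x => complex.Re (g x)) &
      integrable (fun x => complex.Im (g x))].
Proof.
move=> [[mRe mIm] fin].
have sum : integrable (fun x => complex.Re (g x) ^+ 2 + complex.Im (g x) ^+ 2).
  apply/integrableP; split.
    apply/measurable_EFinP.
    by apply: measurable_funD; apply: (measurable_funX 2).
  have := poweR_lty 2 fin.
  rewrite poweR_Lnorm//; congr (_ < +oo)%E; apply: eq_integral => x _ /=.
  rewrite powR_mulrn// real_normK ?num_real// -[Normc.normc _]/(complex.Re `|g x|).
  by rewrite sqr_Re_norm ger0_norm ?addr_ge0 ?sqr_ge0.
have iRe : integrable (fun x => complex.Re (g x) ^+ 2).
  apply: le_integrable sum => //.
    by apply/measurable_EFinP; apply: (measurable_funX 2).
  move=> x _ /=; rewrite lee_fin !ger0_norm ?addr_ge0 ?sqr_ge0//.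
  by rewrite lerDl sqr_ge0.
have iIm : integrable (fun x => complex.Im (g x) ^+ 2).
  apply: le_integrable sum => //.
    by apply/measurable_EFinP; apply: (measurable_funX 2).
  move=> x _ /=; rewrite lee_fin !ger0_norm ?addr_ge0 ?sqr_ge0//.
  by rewrite lerDr sqr_ge0.
by split=> //; exact: integrable_of_sqr.
Qed.

(** Invariance of the measure makes the integral of [|g|^2] equal to [|l|^2] times itself, and it is
    nonzero because [g] is not almost everywhere 0. *)
Lemma norm_eigenvalue (S : T -> T) (g : T -> R[i]) (l : R[i]) :
  measure_preserving mu S -> in_Lp mu 2%:E g ->
  ~ {ae mu, forall x, g x = 0} -> {ae mu, forall x, g (S x) = l * g x} ->
  complex.Re l ^+ 2 + complex.Im l ^+ 2 = 1.
Proof.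
move=> pS Lg g0 gS; have [[mRe mIm] _] := Lg.
have [iRe iIm _ _] := in_L2_integrable Lg.
pose v x := complex.Re (g x) ^+ 2 + complex.Im (g x) ^+ 2.
have v0 x : 0 <= v x by rewrite addr_ge0 ?sqr_ge0.
have iv : integrable v by have := integrableD measurableT iRe iIm; exact: eq_integrable.
have /measurable_EFinP mv := measurable_int _ iv.
pose c := complex.Re l ^+ 2 + complex.Im l ^+ 2.
have : \int[mu]_x v x = c * \int[mu]_x v x.
  rewrite -[LHS](Rintegral_preserving pS mv) -RintegralZl//.
  apply: ae_eq_Rintegral.
  - exact: measurableT_comp mv pS.1.
  - exact: measurable_funM.
  - apply: ae_imply gS => x; rewrite /v /c => ->.
    by case: (l) (g x) => [a b] [p q] /=; ring.
move/eqP; rewrite -subr_eq0 -{1}[X in X - _]mul1r -mulrBl mulf_eq0.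
move=> /orP[|/eqP v_0]; first by rewrite subr_eq0 => /eqP/esym.
case: g0.
have : ae_eq mu setT (EFin \o v) (cst 0%E).
  apply/ae_eq_integral_abs => //; first exact/measurable_EFinP.
  transitivity (\int[mu]_x (v x)%:E)%E.
    by apply: eq_integral => x _; rewrite /= ger0_norm.
  by rewrite -(fineK (integrable_fin_num measurableT iv)) [fine _]v_0.
apply: ae_imply => x /(_ I)[] /eqP; rewrite paddr_eq0 ?sqr_ge0// !sqrf_eq0.
by case: (g x) => p q /= /andP[/eqP-> /eqP->].
Qed.

End SquareIntegrability.

(** * The character [e(t)] is orthogonal to the Kronecker factor *)

Section Kronecker.
Context (R : realType).
Local Notation torus := (measurableTypeR R * measurableTypeR R)%type.
Local Notation nu := (torus_prob R).

Lemma eigenfunction_half_turn (g : torus -> R[i]) :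
  eigenfunction nu (skew id) g -> {ae nu, forall y, g (half_turn y) = g y}.
Proof.
move=> [Lg g0 [l gS]].
have pS : measure_preserving nu (skew id) by exact: skew_preserving.
have l1 := norm_eigenvalue pS Lg g0 gS.
have [iRe2 iIm2 iRe iIm] := in_L2_integrable Lg.
have HRe := ae_half_turn_of_eigenpair iRe iRe2 iIm iIm2 l1.
(* For the imaginary part the pair is swapped: [Im g + i Re g] is [i] times the conjugate of [g],
   with the conjugate eigenvalue. *)
have l1' : complex.Re l ^+ 2 + (- complex.Im l) ^+ 2 = 1 by rewrite sqrrN.
have HIm := ae_half_turn_of_eigenpair iIm iIm2 iRe iRe2 l1'.
have {}HRe : {ae nu, forall y, complex.Re (g (half_turn y)) = complex.Re (g y)}.
  by apply: HRe; apply: ae_imply gS => y ->; case: (l) (g y) => [a b] [p q] /=; ring.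
have {}HIm : {ae nu, forall y, complex.Im (g (half_turn y)) = complex.Im (g y)}.
  by apply: HIm; apply: ae_imply gS => y ->; case: (l) (g y) => [a b] [p q] /=; ring.
apply: filterS2 HRe HIm => y.
by case: (g (half_turn y)) (g y) => [a b] [p q] /= -> ->.
Qed.

(** The character [e(x) = exp(2 pi i x)]. *)
Definition unit_exp (x : R) : R[i] := Complex (cos (pi *+ 2 * x)) (sin (pi *+ 2 * x)).

Lemma unit_expD x y : unit_exp (x + y) = unit_exp x * unit_exp y.
Proof. by rewrite /unit_exp mulrDr cosD sinD; congr Complex; ring. Qed.

Lemma unit_exp_nat (n : nat) : unit_exp n%:R = 1.
Proof.
elim: n => [|n IH]; first by rewrite /unit_exp mulr0 cos0 sin0.
by rewrite mulrSr unit_expD IH mul1r /unit_exp mulr1 cos2pi sin2pi.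
Qed.

Lemma unit_exp0 : unit_exp 0 = 1.
Proof. exact: (unit_exp_nat 0). Qed.

Lemma unit_exp_mulN x : unit_exp x * unit_exp (- x) = 1.
Proof. by rewrite -unit_expD subrr unit_exp0. Qed.

Lemma unit_expDz x (k : int) : unit_exp (x + k%:~R) = unit_exp x.
Proof.
rewrite unit_expD; suff -> : unit_exp k%:~R = 1 by rewrite mulr1.
case: k => n; first exact: unit_exp_nat.
by rewrite NegzE mulrNz -[LHS]mul1r -[X in X * _](unit_exp_nat n.+1) unit_exp_mulN.
Qed.

Lemma unit_exp_frac x : unit_exp (frac x) = unit_exp x.
Proof. by have [k ->] := fracE x; rewrite unit_expDz. Qed.

Lemma unit_exp_half : unit_exp (1 / 2) = -1.
Proof.
rewrite /unit_exp (_ : pi *+ 2 * (1 / 2) = pi); last by rewrite mulr2n; field.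
by rewrite cospi sinpi; apply/eqP; rewrite eq_complex/= oppr0 !eqxx.
Qed.

Lemma norm_unit_exp x : `|unit_exp x| = 1.
Proof. by rewrite normc_def /unit_exp/= cos2Dsin2 sqrtr1. Qed.

Definition phase (y : torus) : R[i] := unit_exp y.2.

Lemma cmeasurable_phase : cmeasurable_fun phase.
Proof.
by split; apply: (@measurableT_comp _ _ _ _ _ _ (_ : R -> R) _
    (fun y : torus => pi *+ 2 * y.2));
  [apply: continuous_measurable_fun; exact: continuous_cos|exact: measurable_funM|
   apply: continuous_measurable_fun; exact: continuous_sin|exact: measurable_funM].
Qed.

Lemma phase_half_turn y : phase (half_turn y) = - phase y.
Proof. by rewrite /phase /half_turn/= unit_exp_frac unit_expD unit_exp_half mulrN1. Qed.

Lemma Re_norm_phase : (fun y => complex.Re `|phase y|) = cst 1.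
Proof. by apply/funext => y; rewrite norm_unit_exp. Qed.

Lemma phase_in_Loo : in_Lp nu +oo%E phase.
Proof.
split; first exact: cmeasurable_phase.
rewrite Re_norm_phase /finite_norm unlock; case: ifPn => // _.
apply: (@le_lt_trans _ _ 1%E); last exact: ltry.
by apply/ess_supP; apply: aeW => y; rewrite /= normr1.
Qed.

Lemma phase_in_L2 : in_Lp nu 2%:E phase.
Proof.
split; first exact: cmeasurable_phase.
rewrite Re_norm_phase /finite_norm -[EFin \o _]/(cst 1%E) Lnorm_cst1.
by rewrite -[X in (X `^ _)%E]/(nu setT) probability_setT poweR_lty// ltry.
Qed.

(** A Kronecker measurable [g] is invariant under the half turn while [phase] changes sign, so both
    coordinates of the inner product are integrals of odd functions. *)
Lemma phase_kronecker_perp : kronecker_perp nu (skew id) phase.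
Proof.
split; first exact: phase_in_L2.
move=> g [[mRe mIm] _] Kg.
have [mc ms] := cmeasurable_phase.
have [gRe gIm] := kronecker_measurable_ae_invariant eigenfunction_half_turn Kg.
have pH : measure_preserving nu (@half_turn R) by exact: skew_preserving.
have fgH : {ae nu, forall y,
    phase (half_turn y) * (g (half_turn y))^*%C = - (phase y * (g y)^*%C)}.
  apply: filterS2 gRe gIm => y; rewrite phase_half_turn mulNr.
  by case: (g (half_turn y)) (g y) => [a b] [p q] /= -> ->.
rewrite /inner; congr Complex; apply: (integral_odd pH).
- rewrite (_ : (fun y => _) = fun y => complex.Re (phase y) * complex.Re (g y) +
      complex.Im (phase y) * complex.Im (g y)).
    by apply: measurable_funD; exact: measurable_funM.
  by apply/funext => y; case: (phase y) (g y) => [a b] [p q] /=; ring.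
- by apply: ae_imply fgH => y ->; case: (_ * _).
- rewrite (_ : (fun y => _) = fun y => complex.Im (phase y) * complex.Re (g y) -
      complex.Re (phase y) * complex.Im (g y)).
    by apply: measurable_funB; exact: measurable_funM.
  by apply/funext => y; case: (phase y) (g y) => [a b] [p q] /=; ring.
- by apply: ae_imply fgH => y ->; case: (_ * _).
Qed.

End Kronecker.

(** * Signs with divergent Cesaro means *)

Section DyadicSigns.
Context (K : numFieldType).

Definition dyadic_sign (n : nat) : K := (-1) ^+ trunc_log 2 n.

Lemma norm_dyadic_sign n : `|dyadic_sign n| = 1.
Proof. by rewrite normrX normrN1 expr1n. Qed.

(** The block from [2 ^ k] to [2 ^ k.+1] contributes [(- 2) ^+ k], so the sum is geometric of ratio
    -2. *)
Lemma sum_dyadic_sign k :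
  3 * \sum_(1 <= n < 2 ^ k) dyadic_sign n = 1 - (- 2) ^+ k.
Proof.
elim: k => [|k IH]; first by rewrite big_geq// mulr0 expr0 subrr.
have k12 : (2 ^ k <= 2 ^ k.+1)%N by rewrite leq_exp2l.
rewrite (big_cat_nat (n := 2 ^ k))//= ?expn_gt0// mulrDr IH.
rewrite (eq_big_nat _ _ (F2 := fun=> (-1) ^+ k)); last first.
  by move=> n nk; rewrite /dyadic_sign (@trunc_log_eq 2 k).
rewrite sumr_const_nat expnS mul2n -addnn addnK -[_ *+ (2 ^ k)%N]mulr_natr natrX exprS.
by rewrite exprNn; ring.
Qed.

(** At [N = 2^k - 1] the mean is [(1 - (-2)^k) / (3 (2^k - 1))]: it equals -1/3 for even positive
    [k] and exceeds 1/3 for odd [k]. *)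
Lemma dyadic_sign_means_apart (j : nat) (mean : nat -> K) :
  (forall N, mean N = N%:R^-1 * \sum_(1 <= n < N.+1) dyadic_sign n) ->
  2 / 3 <= `|mean (2 ^ (j.*2.+2).+1).-1 - mean (2 ^ j.*2.+2).-1|.
Proof.
(* [q] is the even power [2 ^ j.*2.+2], at least 4, so the denominators below are positive. *)
move=> meanE; pose q := (4 ^ j.+1)%N.
have q1 : (1 < q)%N.
  by rewrite /q expnS (leq_trans (_ : 1 < 4 * 1)%N)// leq_mul2l expn_gt0.
have powE : (2 ^ j.*2.+2 = q)%N by rewrite -doubleS -mul2n expnM.
have powS : (2 ^ (j.*2.+2).+1 = 2 * q)%N by rewrite expnS powE.
have signE : (- 2 : K) ^+ j.*2.+2 = q%:R.
  by rewrite -doubleS -mul2n exprM sqrrN -natrX -natrX.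
have S3 k (z : K) : 3 * \sum_(1 <= n < 2 ^ k) dyadic_sign n = z ->
    mean (2 ^ k).-1 = z / (3 * ((2 ^ k)%:R - 1)).
  move=> <-; rewrite meanE prednK ?expn_gt0// -subn1 natrB ?expn_gt0//.
  have [->|n0] := eqVneq ((2 ^ k)%:R - 1 : K) 0; first by rewrite mulr0 invr0 mul0r mulr0.
  by field.
rewrite (S3 _ _ (sum_dyadic_sign _)) (S3 _ _ (sum_dyadic_sign _)).
rewrite exprS signE powS powE natrM.
have q0 : 0 < q%:R - 1 :> K by rewrite subr_gt0 ltr1n.
have q20 : 0 < 2 * q%:R - 1 :> K.
  by rewrite -natrM subr_gt0 ltr1n (leq_trans q1)// leq_pmull.
rewrite (_ : _ - _ = 2 / 3 + 2 / 3 / (2 * q%:R - 1)); last first.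
  by field; rewrite !gt_eqF.
have pos : 0 <= 2 / 3 / (2 * q%:R - 1) :> K.
  by rewrite divr_ge0 ?divr_ge0// ltW.
have le23 : 2 / 3 <= 2 / 3 + 2 / 3 / (2 * q%:R - 1) :> K by rewrite lerDl.
by rewrite ger0_norm// (le_trans _ le23)// divr_ge0.
Qed.

End DyadicSigns.

(** * Divergence of the weighted averages *)

Section Averages.
Context (R : realType).
Local Notation torus := (measurableTypeR R * measurableTypeR R)%type.
Local Notation nu := (torus_prob R).

Lemma phase_iter (n : nat) (y : torus) :
  phase (iter n (skew id) y) = unit_exp y.1 ^+ n * phase y.
Proof.
have fst_iter m : (iter m (skew id) y).1 = y.1 by elim: m.
elim: n => [|n IH]; first by rewrite mul1r.
rewrite iterS {1}/phase /skew/= /rot unit_exp_frac unit_expD -/(phase _) IH fst_iter exprS.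
by ring.
Qed.

Definition cophase (y : torus) (n : nat) : R[i]^o := unit_exp (- y.1) ^+ n.

Lemma cophase_phase_iter (u : nat -> R[i]) (y : torus) (n m : nat) :
  u n * cophase y n * cophase y m * phase (iter (n + m) (skew id) y) =
  u n * phase y.
Proof.
rewrite phase_iter /cophase -[_ * _ ^+ n * _]mulrA -exprD -mulrA; congr (_ * _).
by rewrite mulrA -exprMn mulrC [unit_exp (- _) * _]mulrC unit_exp_mulN expr1n mulr1.
Qed.

Lemma bounded_unimodular (a : nat -> R[i]^o) :
  (forall n, `|a n| = 1) -> bounded_fun a.
Proof.
move=> a1; exists 1; split=> [|r r1 n _]; first exact: real1.
by have : `|a n| <= r by rewrite a1 ltW.
Qed.

Lemma norm_cophase y n : `|cophase y n| = 1.
Proof. by rewrite normrX norm_unit_exp expr1n. Qed.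

(** The weights cancel the rotation of the phase, so the inner sum is constant in [m]. The general
    [u] and bounds serve both the dyadic signs from 1 and the constant weights from 0. *)
Lemma sum_cophase_phase (u : nat -> R[i]) (y : torus) (i j : nat) :
  \sum_(i <= n < j) \sum_(i <= m < j)
    u n * cophase y n * cophase y m * phase (iter (n + m) (skew id) y) =
  (j - i)%:R * (\sum_(i <= n < j) u n) * phase y.
Proof.
rewrite mulrAC -mulrA [phase y * _]mulrC mulr_suml mulr_sumr; apply: eq_bigr => n _.
under eq_bigr do rewrite cophase_phase_iter.
by rewrite sumr_const_nat mulr_natl.
Qed.

Lemma cvg_eventually_close (x : nat -> R[i]^o) (l : R[i]^o) (r : R[i]) :
  0 < r -> x @ \oo --> l -> exists M, forall N, (M <= N)%N -> `|l - x N| < r.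
Proof. by move=> r0 /cvgrPdist_lt/(_ r r0)[M _ xM]; exists M => N; exact: xM. Qed.

Lemma averages_diverge (y : torus) : exists a b : nat -> R[i]^o,
  [/\ bounded_fun a, bounded_fun b &
      ~ cvgn (fun N : nat => (N%:R ^+ 2)^-1 *
          \sum_(1 <= n < N.+1) \sum_(1 <= m < N.+1)
            a n * b m * phase (iter (n + m) (skew id) y) : R[i]^o)].
Proof.
exists (fun n => dyadic_sign R[i] n * cophase y n), (cophase y); split.
- by apply: bounded_unimodular => n; rewrite normrM norm_dyadic_sign norm_cophase mulr1.
- exact/bounded_unimodular/norm_cophase.
pose mean (N : nat) : R[i] := N%:R^-1 * \sum_(1 <= n < N.+1) dyadic_sign R[i] n.
rewrite (_ : (fun N : nat => _) = fun N => (mean N * phase y : R[i]^o)); last first.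
  apply/funext => N; rewrite sum_cophase_phase subn1/= /mean.
  have [->|N0] := eqVneq (N%:R : R[i]) 0; first by rewrite !(expr0n, invr0, mul0r).
  by field.
(* Closeness 1/3 to a limit would keep any two late averages less than 2/3 apart. *)
move=> /cvg_ex[l /(@cvg_eventually_close _ _ (3^-1))]; rewrite invr_gt0 ltr0n.
move=> /(_ isT)[M close].
(* Since [2^k - 1] is at least [k], the comparison of means with [j = M] takes place beyond [M]. *)
have large k : (M <= k)%N -> (M <= (2 ^ k).-1)%N.
  by move=> Mk; rewrite -ltnS prednK ?expn_gt0// (leq_ltn_trans Mk)// ltn_expl.
have Mk : (M <= M.*2.+2)%N by rewrite -addnn -!addnS leq_addr.
have apart := dyadic_sign_means_apart M (fun N => erefl (mean N)).
have c1 := close _ (large _ Mk); have c2 := close _ (large _ (leqW Mk)).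
rewrite distrC in c2.
have : `|mean (2 ^ M.*2.+3).-1 - mean (2 ^ M.*2.+2).-1| < 2 / 3.
  (* Multiplication by [phase y], of modulus 1, turns the means into the averages without changing
     distances. *)
  rewrite -[ltLHS]mulr1 -[X in _ * X](norm_unit_exp y.2) -normrM mulrBl.
  rewrite (_ : _ - _ = (mean (2 ^ M.*2.+3).-1 * phase y - l) +
    (l - mean (2 ^ M.*2.+2).-1 * phase y)); last by rewrite addrA subrK.
  rewrite (le_lt_trans (ler_normD _ _))// (_ : 2 / 3 = 3^-1 + 3^-1); last by field.
  exact: ltrD.
by move=> /(le_lt_trans apart); rewrite ltxx.
Qed.

Lemma averages_not_vanish : ~ weighted_averages_vanish nu (skew id).
Proof.
move=> /(_ _ (phase_kronecker_perp R)) vanish.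
have : {ae nu, forall y, False}.
  (* With these weights and [c = 1], the first average equals [phase y] for every positive [N], so
     it stays at distance 1 from 0. *)
  apply: ae_imply vanish => y /(_ (cophase y) (cophase y) (fun=> 1)).
  case; do ?by apply: bounded_unimodular => n; rewrite ?norm_cophase ?normr1.
  move=> /(@cvg_eventually_close _ _ 1 ltr01)[M close] _ _.
  have := close M.+1 (leqnSn M).
  have := sum_cophase_phase (fun=> 1) y 0 M.+1.
  under eq_bigr do under eq_bigr do rewrite mul1r.
  move=> ->; rewrite subn0 sumr_const_nat subn0 sub0r normrN -expr2 mulrA mulVf.
    by rewrite mul1r norm_unit_exp ltxx.
  by rewrite expf_neq0// pnatr_eq0.
(* An almost everywhere false statement would make the whole probability space a null set. *)
move=> [N [mN N0 sN]]; have : (nu setT <= 0)%E.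
  by rewrite -N0; apply: le_measure; rewrite ?inE// => y _; exact: sN.
by rewrite probability_setT lee_fin ler10.
Qed.

End Averages.

Theorem proposition7 (R : realType) :
  exists (d : measure_display) (Y : measurableType d)
         (nu : probability Y R) (S : Y -> Y),
    [/\ measure_preserving nu S,
        ~ ergodic nu S,
        (exists f : Y -> R[i],
          [/\ in_Lp nu +oo%E f,
              kronecker_perp nu S f &
              {ae nu, forall y, exists a b : nat -> R[i]^o,
                [/\ bounded_fun a, bounded_fun b &
                    ~ cvgn (fun N : nat =>
                        (N%:R ^+ 2)^-1 *
                        \sum_(1 <= n < N.+1) \sum_(1 <= m < N.+1)
                          a n * b m * f (iter (n + m) S y) : R[i]^o)]}]) &
        ~ weighted_averages_vanish nu S].
Proof.
exists _, _, (torus_prob R), (skew id); split.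
- exact: skew_preserving.
- exact: skew_id_not_ergodic.
- exists (@phase R); split.
  + exact: phase_in_Loo.
  + exact: phase_kronecker_perp.
  + by apply: aeW => y; exact: averages_diverge.
- exact: averages_not_vanish.
Qed.
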